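(* For all $\alpha\in(1,2)$ and all integers $k\ge3$ and $r\ge1$, $$\lim_{N\to\infty}\frac1N\#\{n\in[1,N]\cap\mathbb{Z} : (\lfloor (n+rj)^\alpha\rfloor)_{j=0}^{k-1}\in\mathcal{P}_{k,1}\}=\frac{1}{k-1}.$$
   Context: $\lfloor x\rfloor$ is the greatest integer $\le x$. $\mathcal{P}_{k,1}$ is the set of all strictly increasing sequences $(a(n))_{n=0}^{k-1}$ of positive integers such that the difference $a(n+1)-a(n)$ is the same for all $0\le n\le k-2$, i.e. the arithmetic progressions of length $k$. *)

(* Defs.v *)
From HB Require Import structures.
From mathcomp Require Import all_boot all_order all_algebra.
From mathcomp Require Import all_classical all_reals all_analysis.
Set Implicit Arguments.
Unset Strict Implicit.
Unset Printing Implicit Defensive.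
Import Order.TTheory GRing.Theory Num.Theory.
Import numFieldNormedType.Exports.
Local Open Scope classical_set_scope.
Local Open Scope ring_scope.

(* The set written P_{k,1}. *)
Definition arith_prog (k : nat) : set (k.-tuple int) :=
  [set a : k.-tuple int |
    [/\ forall n : nat, (n < k)%N -> 0 < a`_n,
        forall n : nat, (n.+1 < k)%N -> a`_n < a`_n.+1 &
        exists d : int, forall n : nat, (n.+1 < k)%N -> a`_n.+1 - a`_n = d]].
Arguments arith_prog : clear implicits.

Definition floor_pow_seq (R : realType) (alpha : R) (r k n : nat) :
    k.-tuple int :=
  [tuple Num.floor (((n + r * j)%N%:R : R) `^ alpha) | j < k].

(* Main.v *)
Require Import Defs.
From HB Require Import structures.
From mathcomp Require Import all_boot all_order all_algebra.
From mathcomp Require Import all_classical all_reals all_analysis.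
From mathcomp Require Import ring lra zify.
Set Implicit Arguments.
Unset Strict Implicit.
Unset Printing Implicit Defensive.
Import Order.TTheory GRing.Theory Num.Theory.
Import numFieldNormedType.Exports.
Local Open Scope classical_set_scope.
Local Open Scope ring_scope.

(** Fix a block length H and look at n = m + h with h < H and m large. As
    alpha < 2, the second derivative of x^alpha tends to 0, so on the whole block
      (n + r j)^alpha = m^alpha + (h + r j) theta + o(1),
      theta = alpha m^(alpha - 1).
    Write r theta = p + s with p the nearest integer. The floors of
    X + j (p + s), for 0 <= j < k, are in progression exactly when no X + j s
    leaves the unit interval [floor X, floor X + 1), that is, when the fractional
    part of X = m^alpha + h theta lies in a certain interval of length
    max (0, 1 - (k - 1) |s|); see [floor_progression_of_window] and
    [window_of_floor_progression], where the o(1) costs a margin eta at the ends.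
    The common difference is p, which is positive once theta is large.
    This length is [tent (k - 1) (r theta)], where [tent c] is the 1-periodic
    spike of height 1 and slope c at the integers; its mean is 1/c.

    Two equidistribution facts give the density.

    Inside a block, the points m^alpha + h theta form a rotation. Dirichlet gives
    a reduced fraction p'/q with q <= Q and |q theta - p'| < 1/Q. Any q
    consecutive points then fill every interval correctly up to an error of 3
    ([window_sum_short]), because multiplication by p' permutes the residues
    modulo q. With H = Q! the block is cut exactly into pieces of length q, and
    the relative error is O(1/q), which is small unless q <= K.

    Across blocks, a sequence such as b n^(alpha - 1), which grows without bound
    with steps decreasing slowly to 0, is equidistributed modulo 1 (Fejer). For
    the functions [tent c] this is [mean_tent_along_power]: the difference
    tent c - 1/c has an explicit periodic antiderivative, and an Abel summation
    bounds its sums. So the average of [tent (k - 1) (r theta)] over m tends to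
    1/(k - 1). The same statement controls the blocks with q <= K: there
    q theta is within 1/Q of an integer, so 2 [tent (Q/2) (q theta)] >= 1, and the
    average of these over m, summed over q <= K, is 4K/Q = 1/K for Q = 4 K^2.
    Letting K grow finishes the proof ([mean_cvg_of_blocks], [mean_good]). *)

(** * Floor sums and rotations by nearly rational angles *)

Section FloorSums.
Variable R : archiRealFieldType.
Implicit Types (x y z u v theta : R) (p n : int) (q h : nat).

Lemma floor_eq_of_bounds x n : n%:~R <= x < n%:~R + 1 -> Num.floor x = n.
Proof. by move=> H; apply: Num.Theory.floor_def; rewrite intrD. Qed.

Lemma floor_bounds x :
  (Num.floor x)%:~R <= x /\ x < (Num.floor x)%:~R + 1.
Proof. by have /andP[] := Num.Theory.floor_itv x; rewrite intrD. Qed.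

Lemma floor_shift x n : Num.floor (x + n%:~R) = Num.floor x + n.
Proof.
apply: floor_eq_of_bounds; have [] := floor_bounds x.
by rewrite intrD => ? ?; apply/andP; split; lra.
Qed.

(** The residues of p h modulo q, for h < q, are 0, ..., q - 1 in some order, and
    replacing p h by its residue changes each floor by an integer that does not
    depend on z. So all increments in z can be computed with p = 1. *)
Lemma floor_sum_permute q p : (0 < q)%N -> coprimez p q%:Z ->
  exists c : int, forall z,
    \sum_(h < q) Num.floor (z + (p * h%:Z)%:~R / q%:R)
    = \sum_(t < q) Num.floor (z + t%:R / q%:R) + c.
Proof.
case: q => // q _ cop.
have q0 : q.+1%:Z != 0 by [].
have lt_mod (h : 'I_q.+1) : (absz (modz (p * h%:Z) q.+1) < q.+1)%N.
  by have := modz_ge0 (p * h%:Z) q0; have := ltz_mod (p * h%:Z) q0; lia.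
pose s (h : 'I_q.+1) := Ordinal (lt_mod h).
have s_inj : injective s.
  move=> a b /(congr1 val) /= E; apply: val_inj => /=.
  have {}E : (modz (p * a%:Z) q.+1 == modz (p * b%:Z) q.+1).
    have := modz_ge0 (p * a%:Z) q0; have := modz_ge0 (p * b%:Z) q0; lia.
  move: E; rewrite eqz_mod_dvd -mulrBr Gauss_dvdzr; last first.
    by rewrite coprimez_sym.
  move=> /dvdzP [t E]; have := ltn_ord a; have := ltn_ord b.
  case: (ltrgtP t 0) => t0; nia.
exists (\sum_(h < q.+1) divz (p * h%:Z) q.+1) => z.
rewrite [X in _ = X + _](reindex_inj s_inj) /= -big_split /=.
apply: eq_bigr => h _; rewrite -floor_shift; congr Num.floor.
rewrite {1}(divz_eq (p * h%:Z) q.+1) intrD intrM.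
rewrite -addrA; congr (_ + _); rewrite mulrDl mulfK ?pnatr_eq0 // addrC.
congr (_ + _); congr (_ / _).
by rewrite -[RHS]/((absz (modz (p * h%:Z) q.+1))%:Z%:~R) gez0_abs ?modz_ge0.
Qed.


(** Moving z by 1/q shifts the index t by one: the term t = 0 is lost and the term
    t = q, which exceeds it by exactly 1, is gained. *)
Lemma floor_sum_step q z : (0 < q)%N ->
  \sum_(t < q) Num.floor (z + q%:R^-1 + t%:R / q%:R)
  = \sum_(t < q) Num.floor (z + t%:R / q%:R) + 1.
Proof.
move=> q0; have qn0 : q%:R != 0 :> R by rewrite pnatr_eq0 -lt0n.
pose F t := Num.floor (z + t%:R / q%:R).
transitivity (\sum_(t < q) F t.+1).
  by apply: eq_bigr => t _; congr Num.floor; rewrite -natr1; field.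
have := big_ord_recl q (fun t : 'I_q.+1 => F t) : \sum_(_ < _) _ = _ + _.
rewrite big_ord_recr /= => E; apply: (addrI (F 0%N)); rewrite -{}E addrCA.
congr (_ + _).
by rewrite /F mul0r addr0 divff // -[1 in LHS]/(1%:~R) floor_shift.
Qed.

Lemma floor_sum_steps q m z : (0 < q)%N ->
  \sum_(t < q) Num.floor (z + m%:R / q%:R + t%:R / q%:R)
  = \sum_(t < q) Num.floor (z + t%:R / q%:R) + m%:Z.
Proof.
move=> q0; elim: m => [|m IHm].
  by rewrite addr0; apply: eq_bigr => t _; rewrite mul0r addr0.
transitivity (\sum_(t < q)
    Num.floor ((z + m%:R / q%:R) + q%:R^-1 + t%:R / q%:R)).
  apply: eq_bigr => t _; congr (Num.floor (_ + _)).
  by rewrite -natr1 mulrDl mul1r addrA.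
by rewrite floor_sum_step // IHm -addrA -addn1 PoszD.
Qed.

Lemma floor_sum_mono q z w : z <= w ->
  \sum_(t < q) Num.floor (z + t%:R / q%:R)
  <= \sum_(t < q) Num.floor (w + t%:R / q%:R).
Proof. by move=> le_zw; apply: ler_sum => t _; apply: le_floor; lra. Qed.

(** Monotonicity in z and unit jumps at steps of 1/q leave no room for an error
    larger than one jump. *)
Lemma floor_sum_increment q z w : (0 < q)%N -> z <= w ->
  `|(\sum_(t < q) Num.floor (w + t%:R / q%:R)
     - \sum_(t < q) Num.floor (z + t%:R / q%:R))%:~R - q%:R * (w - z)| <= 1 :> R.
Proof.
move=> q0 le_zw; have qr0 : 0 < q%:R :> R by rewrite ltr0n.
have [] := floor_bounds (q%:R * (w - z)).
have : 0 <= Num.floor (q%:R * (w - z)).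
  by rewrite floor_ge0 mulr_ge0 ?subr_ge0 // ltW.
case: (Num.floor _) => // m _; rewrite -[(Posz m)%:~R]/(m%:R : R) => lo hi.
have lo' : z + m%:R / q%:R <= w.
  by rewrite -lerBrDl ler_pdivrMr // mulrC.
have hi' : w <= z + m.+1%:R / q%:R.
  by rewrite -lerBlDl ler_pdivlMr // mulrC -natr1 ltW.
have := floor_sum_mono q lo'; have := floor_sum_mono q hi'.
rewrite !floor_sum_steps //; set A := \sum_(t < q) _; set B := \sum_(t < q) _.
rewrite -addn1 PoszD -lerBlDl -[B + _ <= _]lerBrDl => h1 h2.
move: h1 h2; rewrite -!(ler_int R) !intrD -[(Posz m)%:~R]/(m%:R : R) intrN.
by move=> h1 h2; rewrite ler_norml; apply/andP; split; lra.
Qed.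

(** The number of integers in (x - v, x - u]. For u <= v <= u + 1 it is the
    indicator of x mod 1 lying in [u, v); as a difference of floors it is well
    suited to summation, and it handles intervals that straddle an integer. *)
Definition window u v x : int := Num.floor (x - u) - Num.floor (x - v).

Lemma window_ge0 u v x : u <= v -> 0 <= window u v x.
Proof. by move=> uv; rewrite subr_ge0; apply: le_floor; lra. Qed.

Lemma window_le1 u v x : v <= u + 1 -> window u v x <= 1.
Proof.
move=> vu; rewrite lerBlDl addrC -floor_shift; apply: le_floor.
by rewrite -[1%:~R]/(1 : R); lra.
Qed.

Lemma window_ge1 n u v x : u <= x - n%:~R < v -> 1 <= window u v x.
Proof.
move=> /andP[lo hi]; rewrite /window.
have : n <= Num.floor (x - u) by rewrite floor_ge_int; lra.
have : Num.floor (x - v) < n by rewrite floor_lt_int; lra.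
lia.
Qed.

Lemma window_gt0 u v x : 0 < window u v x -> exists n : int, u <= x - n%:~R < v.
Proof.
rewrite subr_gt0 => lt_fl; exists (Num.floor (x - u)).
have [] := floor_bounds (x - u) => lo hi.
by move: lt_fl; rewrite floor_lt_int => lt_fl; apply/andP; split; lra.
Qed.

(** For h < q the point h theta is within 1/q of p h / q. By monotonicity of the
    floor this costs at most the effect of moving both end points by 1/q, that
    is 2 in the count; the remaining 1 comes from [floor_sum_increment]. *)
Lemma window_sum_short q p theta u v x : (0 < q)%N -> coprimez p q ->
  `|q%:R * theta - p%:~R| <= q%:R^-1 -> u <= v ->
  `|(\sum_(h < q) window u v (x + h%:R * theta))%:~R - q%:R * (v - u)| <= 3%:R :> R.
Proof.
move=> q0 cop; rewrite ler_norml => /andP[lo hi] uv.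
have qr0 : 0 < q%:R :> R by rewrite ltr0n.
set d := q%:R^-1 in lo hi *; have qd : q%:R * d = 1 by rewrite mulfV // lt0r_neq0.
have d0 : 0 < d by rewrite invr_gt0.
have close (h : 'I_q) : - d <= h%:R * theta - (p * h%:Z)%:~R / q%:R <= d.
  have -> : h%:R * theta - (p * h%:Z)%:~R / q%:R
      = (h%:R * d) * (q%:R * theta - p%:~R).
    rewrite intrM -[(Posz h)%:~R]/(h%:R : R) /d; field; exact: lt0r_neq0.
  have hd0 : 0 <= h%:R * d by rewrite mulr_ge0 // ltW.
  have hd1 : h%:R * d <= 1.
    by rewrite -[X in _ <= X]qd ler_pM2r // ler_nat ltnW.
  by apply/andP; split; nra.
have [c Ec] := floor_sum_permute q0 cop.
pose S z := \sum_(h < q) Num.floor (z + (p * h%:Z)%:~R / q%:R).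
have up z e : \sum_(h < q) Num.floor (x + h%:R * theta - e) <= S (x - e + d).
  by apply: ler_sum => h _; apply: le_floor; have /andP[] := close h; lra.
have dn z e : S (x - e - d) <= \sum_(h < q) Num.floor (x + h%:R * theta - e).
  by apply: ler_sum => h _; apply: le_floor; have /andP[] := close h; lra.
have diffS z w : z <= w -> `|(S w - S z)%:~R - q%:R * (w - z)| <= 1.
  by rewrite /S !Ec => zw; rewrite opprD addrACA subrr addr0; apply: floor_sum_increment.
have h2d : x - v - d <= x - u + d by lra.
have h1 : (\sum_(h < q) window u v (x + h%:R * theta))%:~R
    <= (S (x - u + d) - S (x - v - d))%:~R :> R.
  by rewrite ler_int sumrB lerB ?up ?dn.
have := diffS _ _ h2d; rewrite ler_norml => /andP[_].
have -> : q%:R * (x - u + d - (x - v - d)) = q%:R * (v - u) + (q%:R * d) *+ 2 by ring.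
rewrite qd => h2.
(* a window shorter than 2/q cannot be shrunk, but then 0 is a good lower bound *)
case: (leP (x - v + d) (x - u - d)) => h3.
  have h4 : (S (x - u - d) - S (x - v + d))%:~R
     <= (\sum_(h < q) window u v (x + h%:R * theta))%:~R :> R.
    by rewrite ler_int sumrB lerB ?up ?dn.
  have := diffS _ _ h3; rewrite ler_norml => /andP[+ _].
  have -> : q%:R * (x - u - d - (x - v + d)) = q%:R * (v - u) - (q%:R * d) *+ 2 by ring.
  rewrite qd => h5; rewrite ler_norml; apply/andP; split; lra.
have h4 : 0 <= (\sum_(h < q) window u v (x + h%:R * theta))%:~R :> R.
  by rewrite ler0z; apply: sumr_ge0 => h _; apply: window_ge0.
have h5 : q%:R * (v - u) <= 2%:R by rewrite -qd; nra.
by rewrite ler_norml; apply/andP; split; lra.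
Qed.

Lemma window_sum_long H q p theta u v x : (0 < q)%N -> (q %| H)%N ->
  coprimez p q -> `|q%:R * theta - p%:~R| <= q%:R^-1 -> u <= v ->
  `|(\sum_(h < H) window u v (x + h%:R * theta))%:~R - H%:R * (v - u)|
  <= 3%:R * H%:R / q%:R :> R.
Proof.
move=> q0 /dvdnP[m ->] cop near uv; have qr0 : q%:R != 0 :> R by rewrite pnatr_eq0 -lt0n.
rewrite natrM mulrA mulfK //; elim: m => [|m IHm].
  by rewrite mul0n big_ord0 !mul0r mulr0 subrr normr0.
rewrite mulSn addnC big_split_ord /=.
have := @window_sum_short q p theta u v (x + (m * q)%:R * theta) q0 cop near uv.
have -> : \sum_(h < q) window u v (x + (m * q)%:R * theta + h%:R * theta)
    = \sum_(h < q) window u v (x + (m * q + h)%:R * theta).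
  by apply: eq_bigr => h _; rewrite natrD mulrDl addrA.
set A := \sum_(_ < _) _; move: IHm; set B := \sum_(_ < _) _ => hB hA.
rewrite intrD -natr1 mulrDl mul1r.
have -> : B%:~R + A%:~R - (m%:R * q%:R + q%:R) * (v - u)
  = (B%:~R - m%:R * q%:R * (v - u)) + (A%:~R - q%:R * (v - u)) :> R by ring.
have -> : 3%:R * (m%:R + 1) = 3%:R * m%:R + 3%:R :> R by ring.
by apply: le_trans (ler_normD _ _) (lerD hB hA).
Qed.

(** Pigeonhole: Q + 1 fractional parts in Q boxes of length 1/Q. Dividing the
    resulting p and q by their gcd only improves the approximation. *)
Lemma dirichlet_coprime (Q : nat) theta : (0 < Q)%N ->
  exists q p, [/\ (0 < q <= Q)%N, coprimez p q &
                 `|q%:R * theta - p%:~R| < Q%:R^-1].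
Proof.
move=> Q0; have Qr0 : 0 < Q%:R :> R by rewrite ltr0n.
pose fr (h : nat) : R := h%:R * theta - (Num.floor (h%:R * theta))%:~R.
have fr_itv h : 0 <= fr h < 1.
  by have [] := floor_bounds (h%:R * theta); rewrite /fr => ? ?; apply/andP; split; lra.
have boxP (h : 'I_Q.+1) : (`|Num.floor (Q%:R * fr h)| < Q)%N.
  have /andP[lo hi] := fr_itv h.
  have : 0 <= Num.floor (Q%:R * fr h) by rewrite floor_ge0 mulr_ge0 // ltW.
  have : Num.floor (Q%:R * fr h) < Q.
    by rewrite floor_lt_int -[Q%:~R]/(Q%:R : R) -[X in _ < X]mulr1 ltr_pM2l.
  lia.
pose box (h : 'I_Q.+1) := Ordinal (boxP h).
have /injectivePn[a [b neq_ab E]] : ~~ injectiveb box.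
  by apply/injectiveP => /leq_card; rewrite !card_ord ltnn.
wlog lt_ab : a b neq_ab E / (a < b)%N.
  move=> wl; have [?|?|/val_inj eq_ab] := ltngtP a b.
  - exact: (wl a b).
  - by apply: (wl b a) => //; rewrite eq_sym.
  - by rewrite eq_ab eqxx in neq_ab.
have {E}close : `|fr b - fr a| < Q%:R^-1.
  move: E => /(congr1 val) /= E.
  have ge0 h : 0 <= Num.floor (Q%:R * fr h).
    by rewrite floor_ge0 mulr_ge0 ?(ltW Qr0) //; case/andP: (fr_itv h).
  have {}E : Num.floor (Q%:R * fr a) = Num.floor (Q%:R * fr b).
    by have := ge0 a; have := ge0 b; lia.
  have [lo hi] := floor_bounds (Q%:R * fr a).
  have [lo' hi'] := floor_bounds (Q%:R * fr b); rewrite E in lo hi.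
  rewrite -(ltr_pM2l Qr0) divff ?lt0r_neq0 // -[X in X * _]gtr0_norm // -normrM.
  by rewrite mulrBr ltr_norml; apply/andP; split; lra.
pose q1 := (b - a)%N; pose p1 := Num.floor (b%:R * theta) - Num.floor (a%:R * theta).
have q10 : (0 < q1)%N by rewrite subn_gt0.
have {}close : `|q1%:R * theta - p1%:~R| < Q%:R^-1.
  rewrite (_ : _ - _ = fr b - fr a) //.
  by rewrite /fr /q1 /p1 natrB ?intrB 1?ltnW //; ring.
pose g := gcdn `|p1| q1; have g0 : (0 < g)%N by rewrite gcdn_gt0 q10 orbT.
have /dvdnP[q2 Eq] : (g %| q1)%N by apply: dvdn_gcdr.
have /dvdzP[p2 Ep] : (g%:Z %| p1)%Z by rewrite dvdzE; apply: dvdn_gcdl.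
have q20 : (0 < q2)%N by move: q10; rewrite Eq muln_gt0 => /andP[].
exists q2, p2; split.
- rewrite q20 /=; have : (q1 <= Q)%N by rewrite /q1; have := ltn_ord b; lia.
  by apply: leq_trans; rewrite Eq leq_pmulr.
- rewrite coprimezE /= /coprime -(eqn_pmul2r g0) mul1n muln_gcdl.
  by rewrite -[X in gcdn (_ * X)]/`|g%:Z|%N -abszM -Ep -Eq.
- apply: le_lt_trans close; rewrite Eq Ep natrM intrM -[g%:~R]/(g%:R : R).
  rewrite mulrAC -mulrBl normrM normr_nat ler_peMr ?normr_ge0 //.
  by rewrite ler1n.
Qed.
End FloorSums.

(** * Slow sequences and the tent functions *)

(** Fejer by Abel summation. If G is an antiderivative of g, then g (f n) is
    (G (f (n+1)) - G (f n)) w n up to C times the step, where w n is the inverse of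
    the step of f at n. The errors add up to a telescoping sum; since w is
    monotone and G is bounded by M, the main terms sum to at most 2 M w N. *)
Lemma slow_sum_bound (R : realFieldType) (g G : R -> R) (C M : R) (f : nat -> R) :
  (forall u d, 0 <= d -> `|G (u + d) - G u - d * g u| <= C * d ^+ 2) ->
  (forall u, `|G u| <= M) ->
  (forall n, 0 < f n.+1 - f n) ->
  (forall n, f n.+2 - f n.+1 <= f n.+1 - f n) ->
  forall N, `|\sum_(n < N.+1) g (f n)|
    <= 2%:R * M / (f N.+1 - f N) + C * (f N.+1 - f 0).
Proof.
move=> primG boundG f_incr f_conc N.
pose w n := (f n.+1 - f n)^-1.
have w0 n : 0 < w n by rewrite invr_gt0.
have w_le n : w n <= w n.+1 by rewrite lef_pV2 // posrE.
have M0 : 0 <= M by apply: le_trans (boundG 0).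
have step n : `|g (f n) - (G (f n.+1) - G (f n)) * w n| <= C * (f n.+1 - f n).
  have := primG (f n) _ (ltW (f_incr n)); rewrite [f n + _]addrC subrK.
  set d := f n.+1 - f n => h.
  have d0 : 0 < d by apply: f_incr.
  rewrite -(ler_pM2r d0) -[C * d * d]mulrA -expr2.
  suff -> : `|g (f n) - (G (f n.+1) - G (f n)) * w n| * d
     = `|G (f n.+1) - G (f n) - d * g (f n)| by [].
  have -> : G (f n.+1) - G (f n) - d * g (f n)
    = - ((g (f n) - (G (f n.+1) - G (f n)) * w n) * d).
    have wd : w n * d = 1 by rewrite mulVf // lt0r_neq0.
    by rewrite [in RHS]mulrBl -mulrA wd mulr1 opprB mulrC.
  by rewrite normrN normrM (gtr0_norm d0).
(* keeping the boundary term on the left makes the bound inductive *)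
have main : `|\sum_(n < N.+1) g (f n) - G (f N.+1) * w N|
    <= M * w N + C * (f N.+1 - f 0).
  elim: N => [|N IHN].
    rewrite big_ord1; have := step 0%N.
    have := ler_pM2r (w0 0%N) `|G (f 0)| M; rewrite boundG.
    set gg := g _; set A := G (f 1); set B := G (f 0) => hB hs.
    have -> : gg - A * w 0%N = (gg - (A - B) * w 0%N) - B * w 0%N by ring.
    apply: le_trans (ler_normB _ _) _; rewrite normrM (gtr0_norm (w0 _)).
    by rewrite addrC lerD.
  rewrite big_ord_recr /=; set S := \sum_(_ < _) _.
  have -> : S + g (f N.+1) - G (f N.+2) * w N.+1
   = (S - G (f N.+1) * w N) + (g (f N.+1) - (G (f N.+2) - G (f N.+1)) * w N.+1)
     - G (f N.+1) * (w N.+1 - w N) by ring.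
  apply: le_trans (ler_normB _ _) _.
  have h1 : `|G (f N.+1) * (w N.+1 - w N)| <= M * (w N.+1 - w N).
    have dw : 0 <= w N.+1 - w N by rewrite subr_ge0.
    by rewrite normrM (ger0_norm dw) ler_wpM2r.
  have h2 := le_trans (ler_normD _ _) (lerD IHN (step N.+1)).
  by apply: le_trans (lerD h2 h1) _; rewrite le_eqVlt; apply/orP; left; apply/eqP; ring.
have hG : `|G (f N.+1) * w N| <= M * w N.
  by rewrite normrM (gtr0_norm (w0 _)) ler_pM2r.
rewrite -[X in `|X|](subrK (G (f N.+1) * w N)) -[(_ - _)^-1]/(w N).
apply: le_trans (ler_normD _ _) _; apply: le_trans (lerD main hG) _.
by rewrite le_eqVlt; apply/orP; left; apply/eqP; ring.
Qed.

Section Tent.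
Variable R : archiRealFieldType.
Implicit Types (u d y c s : R) (p : int).

Definition frac u : R := u - (Num.floor u)%:~R.

Lemma frac_itv u : 0 <= frac u < 1.
Proof.
have /andP[lo hi] := Num.Theory.floor_itv u; move: hi; rewrite intrD /frac => hi.
by apply/andP; split; lra.
Qed.

Lemma frac_shift u s p : 0 <= s < 1 -> u = s + p%:~R -> frac u = s.
Proof.
move=> s01 ->; rewrite /frac (_ : Num.floor _ = p) ?addrK //.
apply: Num.Theory.floor_def; rewrite intrD.
by case/andP: s01 => ? ?; apply/andP; split; lra.
Qed.

(** The Bernoulli polynomials B_2 and B_3, extended with period 1. *)
Definition bernoulli2 u := frac u ^+ 2 - frac u + 6%:R^-1.
Definition bernoulli3 u := frac u ^+ 3 - 3%:R / 2%:R * frac u ^+ 2 + frac u / 2%:R.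

Lemma bernoulli3_bound u : `|bernoulli3 u| <= 1.
Proof.
rewrite /bernoulli3; have /andP[] := frac_itv u; set x := frac u => x0 x1.
have -> : x ^+ 3 - 3%:R / 2%:R * x ^+ 2 + x / 2%:R = x * (1 - x) * (2%:R^-1 - x) by field.
have h : 0 <= x * (1 - x) <= 1 by apply/andP; split; nra.
case/andP: h; set z := x * _ => ? ?.
by rewrite ler_norml; apply/andP; split; nra.
Qed.

Lemma bernoulli2_bound u : `|bernoulli2 u| <= 1.
Proof.
rewrite /bernoulli2; have /andP[] := frac_itv u; set x := frac u => x0 x1.
by rewrite ler_norml; apply/andP; split; nra.
Qed.

(** B_3' = 3 B_2, and B_3 takes the same value at 0 and 1, so its periodic
    extension is still an antiderivative across the integers. A step longer than
    1 is covered by boundedness alone. *)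
Lemma bernoulli_prim u d : 0 <= d ->
  `|bernoulli3 (u + d) - bernoulli3 u - d * (3%:R * bernoulli2 u)| <= 6%:R * d ^+ 2.
Proof.
move=> d0; have [d1|d1] := lerP 1 d.
  have := bernoulli3_bound (u + d); have := bernoulli3_bound u.
  have := bernoulli2_bound u; rewrite !ler_norml => /andP[? ?] /andP[? ?] /andP[? ?].
  by apply/andP; split; nra.
rewrite /bernoulli3 /bernoulli2.
have E : u = frac u + (Num.floor u)%:~R by rewrite /frac subrK.
have /andP[] := frac_itv u; move: E; set x := frac u => E x0 x1.
have [lt1|ge1] := ltrP (x + d) 1.
  rewrite (@frac_shift (u + d) (x + d) (Num.floor u)); last 2 first.
  - by apply/andP; split; lra.
  - by rewrite {1}E; ring.
  have -> : (x + d) ^+ 3 - 3%:R / 2%:R * (x + d) ^+ 2 + (x + d) / 2%:R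
    - (x ^+ 3 - 3%:R / 2%:R * x ^+ 2 + x / 2%:R) - d * (3%:R * (x ^+ 2 - x + 6%:R^-1))
    = d ^+ 2 * (3%:R * x + d - 3%:R / 2%:R) by field.
  rewrite normrM ger0_norm ?sqr_ge0 // mulrC ler_wpM2r ?sqr_ge0 //.
  by rewrite ler_norml; apply/andP; split; lra.
rewrite (@frac_shift (u + d) (x + d - 1) (Num.floor u + 1)); last 2 first.
- by apply/andP; split; lra.
- by rewrite {1}E intrD; ring.
set e := x + d - 1.
have -> : e ^+ 3 - 3%:R / 2%:R * e ^+ 2 + e / 2%:R
    - (x ^+ 3 - 3%:R / 2%:R * x ^+ 2 + x / 2%:R) - d * (3%:R * (x ^+ 2 - x + 6%:R^-1))
    = d ^+ 2 * (3%:R * x + d - 3%:R / 2%:R) - 3%:R * e ^+ 2 by rewrite /e; field.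
have h : e ^+ 2 <= d ^+ 2 by rewrite ler_sqr ?nnegrE /e; lra.
by have := sqr_ge0 e; rewrite ler_norml => ?; apply/andP; split; nra.
Qed.

Definition nearest y : int := Num.floor (y + 2%:R^-1).
Definition dist_int y : R := `|y - (nearest y)%:~R|.
Definition tent c y : R := Num.max 0 (1 - c * dist_int y).

Lemma dist_int_le_half y : dist_int y <= 2%:R^-1.
Proof.
rewrite /dist_int /nearest; have /andP[lo hi] := Num.Theory.floor_itv (y + 2%:R^-1).
by move: hi; rewrite intrD ler_norml => hi; apply/andP; split; lra.
Qed.

Lemma dist_int_le y p : dist_int y <= `|y - p%:~R|.
Proof.
have [->//|neq] := eqVneq p (nearest y).
have h : 1 <= `|(nearest y)%:~R - p%:~R| :> R.
  by rewrite -intrB -intr_norm ler1z; lia.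
have := dist_int_le_half y; rewrite /dist_int in h * => h'.
have := ler_distD y (nearest y)%:~R (p%:~R : R).
by rewrite (distrC _ y); lra.
Qed.

Lemma tent_ge0 c y : 0 <= tent c y. Proof. by rewrite le_max lexx. Qed.

Lemma tent_le1 c y : 0 <= c -> tent c y <= 1.
Proof. by move=> c0; rewrite ge_max ler01 lerBlDr lerDl mulr_ge0 /dist_int. Qed.

Lemma tent_ge c y p : 0 <= c -> 1 - c * `|y - p%:~R| <= tent c y.
Proof.
by move=> c0; rewrite le_max; apply/orP; right; rewrite lerB // ler_wpM2l // dist_int_le.
Qed.

Lemma bernoulli2_near y s p : `|s| <= 1 -> y = s + p%:~R ->
  bernoulli2 y = s ^+ 2 - `|s| + 6%:R^-1.
Proof.
rewrite /bernoulli2 => s1 E.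
have [s0|s0] := lerP 0 s; rewrite ?(ger0_norm s0) in s1 *.
  have [lt1|ge1] := ltrP s 1; first by rewrite (@frac_shift y s p) ?s0.
  have -> : s = 1 by lra.
  rewrite (@frac_shift y 0 (p + 1)) ?lexx ?ltr01 //; first by ring.
  rewrite E intrD; lra.
rewrite ?(ltr0_norm s0) in s1 *.
rewrite (@frac_shift y (s + 1) (p - 1)); first by ring.
  by apply/andP; split; lra.
by rewrite E intrB; ring.
Qed.

(** The second derivative of the periodic B_2 is 2 minus twice the Dirac comb at
    the integers. Hence its second difference with step 1/c is
    2 / c^2 - (2 / c) tent c. *)
Lemma tent_bernoulli c y : 2%:R <= c ->
  tent c y - c^-1 = - (c / 2%:R) *
    (bernoulli2 (y + c^-1) - 2%:R * bernoulli2 y + bernoulli2 (y - c^-1)).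
Proof.
move=> c2; have c0 : 0 < c by lra.
set a := c^-1; have ca : c * a = 1 by rewrite divff // lt0r_neq0.
have a0 : 0 < a by rewrite invr_gt0.
have a2 : a <= 2%:R^-1 by nra.
pose p := nearest y; pose s := y - p%:~R.
have Ey : y = s + p%:~R by rewrite subrK.
have s2 : `|s| <= 2%:R^-1 by apply: dist_int_le_half.
have /andP[s2l s2h] : - 2%:R^-1 <= s <= 2%:R^-1 by rewrite -ler_norml.
have h1 : `|s + a| <= 1 by rewrite ler_norml; apply/andP; split; lra.
have h2 : `|s - a| <= 1 by rewrite ler_norml; apply/andP; split; lra.
rewrite (@bernoulli2_near y s p) //; last lra.
rewrite (@bernoulli2_near (y + a) (s + a) p) //; last by rewrite {1}Ey; ring.
rewrite (@bernoulli2_near (y - a) (s - a) p) //; last by rewrite {1}Ey; ring.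
rewrite /tent /dist_int -/p -/s; clearbody s.
have -> : - (c / 2%:R) * ((s + a) ^+ 2 - `|s + a| + 6%:R^-1
   - 2%:R * (s ^+ 2 - `|s| + 6%:R^-1) + ((s - a) ^+ 2 - `|s - a| + 6%:R^-1))
  = c / 2%:R * (`|s + a| + `|s - a| - 2%:R * `|s|) - a * (c * a) by field.
rewrite ca mulr1; congr (_ - _).
have -> : 1 - c * `|s| = c * (a - `|s|) by rewrite mulrBr ca.
have [s0|s0] := lerP 0 s.
  rewrite [`|s|]ger0_norm // [`|s + a|]ger0_norm; last lra.
  have [sa|sa] := lerP a s; first by rewrite max_l; [ring | nra].
  by rewrite max_r; [field | rewrite mulr_ge0; lra].
rewrite [`|s|]ltr0_norm // [`|s - a|]ltr0_norm; last lra.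
have [sa|sa] := leP 0 (s + a).
  by rewrite [`|s + a|]ger0_norm // max_r; [field | rewrite mulr_ge0; lra].
by rewrite [`|s + a|]ltr0_norm // max_l; [ring | nra].
Qed.

End Tent.

(** * Means along powers *)

Section Powers.
Variable R : realType.
Implicit Types a b x y : R.

Lemma powR_mean_value a x y : 0 < x -> x <= y ->
  exists2 z, x <= z <= y & y `^ a - x `^ a = a * z `^ (a - 1) * (y - x).
Proof.
move=> x0 xy.
have pos z : z \in `[x, y] -> 0 < z 
  by rewrite in_itv /= => /andP[xz _]; apply: lt_le_trans xz.
have [||z] := @MVT_segment R (@powR R ^~ a) (fun z => a * z `^ (a - 1)) x y xy.
- move=> z; rewrite in_itv /= => /andP[? ?]; apply: is_derive1_powR.
  by apply: pos; rewrite in_itv /= !ltW.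
- apply: derivable_within_continuous => z zxy.
  by have [] := @is_derive1_powR R a _ (pos _ zxy).
- by rewrite in_itv; exists z.
Qed.


Lemma powR_nat_cvg0 b : 0 < b -> n.+1%:R `^ (- b) @[n --> \oo] --> (0 : R).
Proof.
move=> b0.
have -> : (fun n : nat => n.+1%:R `^ (- b)) = (fun n : nat => (n.+1%:R^-1 : R) `^ b).
  apply/funext => n; rewrite -powR_inv1 ?ler0n // -powRrM; congr (_ `^ _); lra.
have /cvg_at_rightP := powR_cvg0 b0; apply; split; last exact: cvg_harmonic.
by move=> n; rewrite invr_gt0.
Qed.

Lemma powR_increment a x y : 0 < x -> x <= y -> 0 <= a -> a <= 1 ->
  a * y `^ (a - 1) * (y - x) <= y `^ a - x `^ a <= a * x `^ (a - 1) * (y - x).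
Proof.
move=> x0 xy a0 a1; have [z /andP[xz zy] ->] := powR_mean_value a x0 xy.
have z0 := lt_le_trans x0 xz.
have mono s t : 0 < s -> s <= t -> t `^ (a - 1) <= s `^ (a - 1).
  move=> s0 st; have t0 := lt_le_trans s0 st.
  rewrite -opprB !powRN lef_pV2 ?posrE ?powR_gt0 //.
  by apply: ge0_ler_powR; rewrite ?nnegrE ?(ltW s0) ?(ltW t0) //; lra.
rewrite !ler_wpM2r ?subr_ge0 //= ler_wpM2l // ?mono //.
Qed.

(** The second-order Taylor remainder, from two applications of the mean value
    theorem; for 1 <= a <= 2 the second derivative is nonincreasing, which is why
    it may be taken at x. *)
Lemma powR_taylor1 a x y : 0 < x -> x <= y -> 1 <= a -> a <= 2%:R ->
  0 <= y `^ a - x `^ a - a * x `^ (a - 1) * (y - x)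
    <= a * (a - 1) * x `^ (a - 2%:R) * (y - x) ^+ 2.
Proof.
move=> x0 xy a1 a2; have [z /andP[xz zy] ->] := powR_mean_value a x0 xy.
have z0 := lt_le_trans x0 xz.
have a1' : 0 <= a - 1 by lra.
have a2' : a - 1 <= 1 by lra.
have /andP[_] := powR_increment x0 xz a1' a2'.
have mono : x `^ (a - 1) <= z `^ (a - 1).
  by apply: ge0_ler_powR; rewrite ?nnegrE ?(ltW x0) ?(ltW z0) //; lra.
have -> : a - 1 - 1 = a - 2%:R by ring.
have p0 : 0 <= x `^ (a - 2%:R) by apply: powR_ge0.
have yx : 0 <= y - x by lra.
rewrite -mulrBl -mulrBr => h.
apply/andP; split; first by rewrite !mulr_ge0 //; lra.
rewrite expr2 !mulrA ler_wpM2r // -!mulrA ler_wpM2l; [|lra|].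
  done.
apply: le_trans h _; rewrite -mulrA ler_wpM2l // ler_wpM2l //; lra.
Qed.

End Powers.


Section Means.
Variable R : realType.

(** For f n = b n^a the step is of order n^(a - 1), so [slow_sum_bound] gives
    O(n^(1 - a)) + O(n^a) = o(n). The index starts at 1 to stay where the power is
    differentiable. *)
Lemma mean_along_power_cvg0 (g G : R -> R) (C M b a : R) :
  (forall u d, 0 <= d -> `|G (u + d) - G u - d * g u| <= C * d ^+ 2) ->
  (forall u, `|G u| <= M) -> 0 < b -> 0 < a -> a < 1 ->
  (\sum_(n < N) g (b * n.+1%:R `^ a)) / N%:R @[N --> \oo] --> (0 : R).
Proof.
move=> primG boundG b0 a0 a1; rewrite -cvg_shiftS /=.
have M0 : 0 <= M by apply: le_trans (boundG 0).
have C0 : 0 <= C by have := primG 0 1 ler01; rewrite expr1n mulr1; apply: le_trans.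
pose f n : R := b * n.+1%:R `^ a.
have nat_gt0 n : 0 < n.+1%:R :> R by rewrite ltr0n.
have incr n : a * n.+2%:R `^ (a - 1) <= n.+2%:R `^ a - n.+1%:R `^ a
    <= a * n.+1%:R `^ (a - 1).
  have := @powR_increment R a n.+1%:R n.+2%:R (nat_gt0 n).
  rewrite ler_nat leqnSn (ltW a0) (ltW a1) => /(_ isT isT isT).
  by rewrite -natrB // subSnn !mulr1.
have f_lower n : b * a * n.+2%:R `^ (a - 1) <= f n.+1 - f n.
  by rewrite /f -mulrBr -mulrA ler_pM2l //; case/andP: (incr n).
have f_incr n : 0 < f n.+1 - f n.
  by apply: lt_le_trans (f_lower n); rewrite !mulr_gt0 // powR_gt0.
have f_conc n : f n.+2 - f n.+1 <= f n.+1 - f n.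
  apply: le_trans (f_lower n); rewrite /f -mulrBr -mulrA ler_pM2l //.
  by case/andP: (incr n.+1).
pose K1 := 4%:R * M / (b * a); pose K2 := 2%:R * C * b.
pose h n : R := K1 * n.+2%:R `^ (- a) + K2 * n.+2%:R `^ (- (1 - a)).
have bound n : `|(\sum_(i < n.+1) g (f i)) / n.+1%:R| <= h n.
  rewrite normrM [`|_^-1|]gtr0_norm ?invr_gt0 //.
  set x : R := n.+2%:R; have x0 : 0 < x by apply: nat_gt0.
  have inv_le : n.+1%:R^-1 <= 2%:R / x.
    rewrite ler_pdivlMr // mulrC ler_pdivrMr // -natrM ler_nat; lia.
  apply: (@le_trans _ _
    ((2%:R * M / (f n.+1 - f n) + C * (f n.+1 - f 0%N)) * (2%:R / x))).
    apply: ler_pM => //.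
    exact: (slow_sum_bound primG boundG f_incr f_conc n).
  have f00 : 0 <= f 0%N by rewrite mulr_ge0 ?powR_ge0 // ltW.
  have E1 : (b * a * x `^ (a - 1))^-1 = (b * a)^-1 * (x * x `^ (- a)).
    rewrite invfM -powRN; congr (_ * _).
    rewrite -[in RHS](powRr1 (ltW x0)) -powRrM -powRD;
      last by rewrite (gt_eqF x0) implybT.
    by congr (_ `^ _); ring.
  have E2 : x `^ a = x * x `^ (- (1 - a)).
    rewrite -[in RHS](powRr1 (ltW x0)) -powRrM -powRD;
      last by rewrite (gt_eqF x0) implybT.
    by congr (_ `^ _); ring.
  have h1 : (f n.+1 - f n)^-1 <= (b * a)^-1 * (x * x `^ (- a)).
    have p0 : 0 < b * a * x `^ (a - 1) by rewrite !mulr_gt0 // powR_gt0.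
    rewrite -E1 lef_pV2 ?posrE //; exact: f_lower.
  have h2 : f n.+1 - f 0%N <= b * (x * x `^ (- (1 - a))).
    by rewrite -E2 /f -/x lerBlDr lerDl.
  have -> : h n = (2%:R * M * ((b * a)^-1 * (x * x `^ (- a)))
      + C * (b * (x * x `^ (- (1 - a))))) * (2%:R / x).
    rewrite /h /K1 /K2 -/x; field.
    by rewrite !gt_eqF.
  rewrite ler_wpM2r ?mulr_ge0 ?invr_ge0 ?(ltW x0) //.
  by rewrite lerD // ler_wpM2l // mulr_ge0.
have h_cvg : h n @[n --> \oo] --> (0 : R).
  have shift e : 0 < e -> n.+2%:R `^ (- e) @[n --> \oo] --> (0 : R).
    by move=> e0; have := @powR_nat_cvg0 R e e0; rewrite -cvg_shiftS.
  have a1' : 0 < 1 - a by rewrite subr_gt0.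
  have := cvgD (cvgM (cvg_cst K1) (shift _ a0)) (cvgM (cvg_cst K2) (shift _ a1')).
  by rewrite !mulr0 addr0; apply.
apply: (@squeeze_cvgr _ _ _ _ (fun n => - h n) h) => //.
  by apply: nearW => n; rewrite -ler_norml; apply: bound.
by rewrite -[X in _ --> X]oppr0; apply: cvgN.
Qed.

Lemma mean_tent_along_power (c b a : R) : 2%:R <= c -> 0 < b -> 0 < a -> a < 1 ->
  (\sum_(n < N) tent c (b * n.+1%:R `^ a)) / N%:R @[N --> \oo] --> c^-1.
Proof.
move=> c2 b0 a0 a1; have c0 : 0 < c by lra.
pose B := @bernoulli3 R.
pose G u := - (c / 2%:R) / 3%:R * (B (u + c^-1) - 2%:R * B u + B (u - c^-1)).
have bound u : `|G u| <= c.
  have := @bernoulli3_bound R (u + c^-1); have := @bernoulli3_bound R (u - c^-1).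
  have := @bernoulli3_bound R u; rewrite -/B !ler_norml => /andP[? ?] /andP[? ?] /andP[? ?].
  by rewrite /G; apply/andP; split; nra.
have prim u d : 0 <= d -> `|G (u + d) - G u - d * (tent c u - c^-1)| <= 8%:R * c * d ^+ 2.
  move=> d0; rewrite (tent_bernoulli _ c2).
  pose D v := B (v + d) - B v - d * (3%:R * bernoulli2 v).
  have hD v : `|D v| <= 6%:R * d ^+ 2 by apply: bernoulli_prim.
  have -> : G (u + d) - G u - d * (- (c / 2%:R) *
      (bernoulli2 (u + c^-1) - 2%:R * bernoulli2 u + bernoulli2 (u - c^-1)))
    = - (c / 2%:R) / 3%:R * (D (u + c^-1) - 2%:R * D u + D (u - c^-1)).
    by rewrite /G /D (addrAC u d c^-1) (addrAC u d (- c^-1)); field.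
  have := hD (u + c^-1); have := hD (u - c^-1); have := hD u.
  rewrite !ler_norml => /andP[? ?] /andP[? ?] /andP[? ?].
  by have := sqr_ge0 d => ?; apply/andP; split; nra.
have := mean_along_power_cvg0 prim bound b0 a0 a1.
move=> /(cvgD (cvg_cst c^-1)); rewrite addr0; apply: cvg_trans.
apply: near_eq_cvg; near=> N.
have N0 : N%:R != 0 :> R by rewrite pnatr_eq0 -lt0n; near: N; exists 1%N.
rewrite -[LHS]/(c^-1 + (\sum_(n < N) (tent c (b * n.+1%:R `^ a) - c^-1)) / N%:R).
rewrite sumrB sumr_const card_ord mulrBl -(mulr_natr c^-1 N) mulfK //.
by rewrite addrC subrK.
Unshelve. all: by end_near. Qed.

End Means.

(** * Floors of a perturbed arithmetic progression *)

Section FloorProgressions.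
Variable R : archiRealFieldType.
Implicit Types (X s eta : R) (p : int) (e : nat -> R).

(** For |s| <= 1/2, the floors of x + j s with 0 <= j < k and 0 <= x < 1 all vanish
    when x and x + (k - 1) s are in [0, 1). This is the interval of x that starts
    at [ap_start k s] and has length [ap_length k s]. *)
Definition ap_start k s : R := Num.max 0 (- (k.-1%:R * s)).
Definition ap_length k s : R := Num.max 0 (1 - k.-1%:R * `|s|).

Lemma ap_length_itv k s : 0 <= ap_length k s <= 1.
Proof. by rewrite le_max lexx ge_max ler01 lerBlDr lerDl mulr_ge0. Qed.

(** The perturbation [e] only pushes upwards, so the window is cut by eta at its
    right end. *)
Lemma floor_progression_of_window k X s eta p e :
  (forall j, (j < k)%N -> 0 <= e j <= eta) ->
  0 < window (ap_start k s) (ap_start k s + Num.max 0 (ap_length k s - eta)) X ->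
  exists n : int, forall j, (j < k)%N ->
    Num.floor (X + j%:R * (p%:~R + s) + e j) = n + p * j%:Z.
Proof.
move=> e_itv /window_gt0[n /andP[lo hi]]; exists n => j jk.
have /andP[e0 e1] := e_itv _ jk; have c0 : 0 <= k.-1%:R :> R by [].
have jc : j%:R <= k.-1%:R :> R by rewrite ler_nat; lia.
have j0 : 0 <= j%:R :> R by [].
rewrite (_ : _ + e j = X - n%:~R + j%:R * s + e j + (n + p * j%:Z)%:~R); last first.
  by rewrite intrD intrM -[j%:~R]/(j%:R : R); ring.
rewrite floor_shift (_ : Num.floor _ = 0) ?add0r //; apply: floor_eq_of_bounds.
move: lo hi; rewrite /ap_start /ap_length; set c : R := k.-1%:R in c0 jc *.
have [l0|l0] := lerP (Num.max 0 (1 - c * `|s|) - eta) 0; first by move=> *; lra.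
have {}l0 : 0 < Num.max 0 (1 - c * `|s|) by lra.
move: l0; rewrite lt_max ltxx /= => l0; rewrite (max_r (ltW l0)).
have [s0|s0] := lerP 0 s.
  have js0 : 0 <= j%:R * s by rewrite mulr_ge0.
  have jcs : j%:R * s <= c * s by rewrite ler_wpM2r.
  rewrite max_l; last by rewrite oppr_le0 mulr_ge0.
  by rewrite ger0_norm // => ? ?; apply/andP; split; lra.
have js0 : j%:R * s <= 0 by rewrite mulr_ge0_le0 // ltW.
have jcs : c * s <= j%:R * s by rewrite ler_wnM2r // ltW.
rewrite max_r; last by rewrite oppr_ge0 mulr_ge0_le0 // ltW.
by rewrite ltr0_norm // => ? ?; apply/andP; split; lra.
Qed.

(** A perturbation can add values of x up to eta below the window or, when
    x >= 1 - eta, change the first floor; the second window accounts for the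
    latter. Otherwise the first floor is that of X. If the common difference
    were p + D with D <> 0, the last floor would be off by (k - 1) D, while
    (k - 1) s is at most (k - 1)/2 in absolute value: impossible as k - 1 >= 2. *)
Lemma window_of_floor_progression k X s eta p e :
  (3 <= k)%N -> `|s| <= 2%:R^-1 -> 0 <= eta ->
  (forall j, (j < k)%N -> 0 <= e j <= eta) ->
  (exists d : int, forall j, (j.+1 < k)%N ->
     Num.floor (X + j.+1%:R * (p%:~R + s) + e j.+1)
     - Num.floor (X + j%:R * (p%:~R + s) + e j) = d) ->
  1 <= window (ap_start k s - eta) (ap_start k s + ap_length k s) X
       + window (1 - eta) 1 X.
Proof.
move=> k3 /[dup] s2 /[!ler_norml] /andP[s2l s2h] eta0 e_itv [d dP].
pose n := Num.floor X; pose x := X - n%:~R.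
have [xlo xhi] : 0 <= x /\ x < 1.
  by have [] := floor_bounds X; rewrite /x /n => ? ?; split; lra.
have /andP[len0 len1] := ap_length_itv k s.
have w1 : 0 <= window (ap_start k s - eta) (ap_start k s + ap_length k s) X.
  by apply: window_ge0; lra.
have w2 : 0 <= window (1 - eta) 1 X by apply: window_ge0; lra.
have [big|small] := lerP (1 - eta) x.
  by rewrite -[1]add0r lerD //; apply: (@window_ge1 _ n); rewrite -/x big.
rewrite -[1]addr0 lerD //; apply: (@window_ge1 _ n); rewrite -/x.
pose v j := Num.floor (X + j%:R * (p%:~R + s) + e j).
have vE j : (j < k)%N -> v j = v 0%N + j%:Z * d.
  elim: j => [|j IHj] jk; first by rewrite mul0r addr0.
  rewrite -(subrK (v j) (v j.+1)) [v j.+1 - _]dP // IHj; last by lia.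
  by rewrite -add1n PoszD; ring.
have k0 : (0 < k)%N by lia.
have v0 : v 0%N = n.
  have /andP[? ?] := e_itv _ k0; rewrite /v mul0r addr0.
  by apply: floor_eq_of_bounds; apply/andP; split; rewrite /x in xlo small; lra.
have kk : (k.-1 < k)%N by lia.
have /andP[e0 e1] := e_itv _ kk.
have c2 : 2%:R <= k.-1%:R :> R by rewrite ler_nat; lia.
have [lo hi] := floor_bounds (X + k.-1%:R * (p%:~R + s) + e k.-1).
move: lo hi; rewrite -/(v k.-1) (vE _ kk) v0 intrD intrM -[k.-1%:~R]/(k.-1%:R : R).
rewrite /ap_start /ap_length; set c : R := k.-1%:R in c2 *.
have EX : X = x + n%:~R by rewrite subrK.
set e' := e _ in e0 e1 * => lo hi.
pose D := d - p.
have {}lo : c * D%:~R <= x + c * s + e' by rewrite /D intrB; lra.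
have {}hi : x + c * s + e' < c * D%:~R + 1 by rewrite /D intrB; lra.
have D0 : D = 0.
  have : D < 1.
    rewrite ltNge; apply/negP; rewrite -(ler_int R) => D1.
    have D1' : 1 <= D%:~R :> R by [].
    by nra.
  have : -1 < D.
    rewrite ltNge; apply/negP; rewrite -(ler_int R) => D1.
    have D1' : D%:~R <= -1 :> R by [].
    by nra.
  lia.
rewrite D0 mulr0 in lo hi.
have [s0|s0] := lerP 0 s.
  have cs0 : 0 <= c * s by rewrite mulr_ge0 //; lra.
  rewrite max_l; last by lra.
  by rewrite ger0_norm // max_r; [apply/andP; split; lra | lra].
have cs0 : c * s <= 0 by rewrite mulr_ge0_le0 ?ltW //; lra.
rewrite max_r; last by lra.
rewrite ltr0_norm //; have : 1 + c * s <= Num.max 0 (1 - c * - s).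
  by rewrite le_max; apply/orP; right; lra.
by move=> ?; apply/andP; split; lra.
Qed.

End FloorProgressions.

(** * Means from blocks *)

Section BlockMeans.
Variable R : realType.

(** As g takes values in [0, 1], its sum over [0, N) changes by at most h when the
    range is translated by h; there are H translates, with h < H. *)
Lemma block_sum_swap (g : nat -> R) (H N : nat) :
  (forall n, 0 <= g n <= 1) ->
  `|H%:R * \sum_(n < N) g n - \sum_(m < N) \sum_(h < H) g (m + h)%N| <= H%:R * H%:R.
Proof.
move=> g01.
have shift h : `|\sum_(m < N) g m - \sum_(m < N) g (m + h)%N| <= h%:R.
  elim: h => [|h IHh].
    by under [X in _ - X]eq_bigr do rewrite addn0; rewrite subrr normr0.
  have E : \sum_(m < N) g (m + h.+1)%N = \sum_(m < N) g (m + h)%N + g (N + h)%N - g h.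
    have := big_ord_recl N (fun m : 'I_N.+1 => g (m + h)%N) : \sum_(_ < _) _ = _ + _.
    rewrite big_ord_recr /= => ->; rewrite add0n addrAC subrr add0r; apply: eq_bigr => m _.
    by rewrite addnS.
  rewrite E.
  have /andP[? ?] := g01 (N + h)%N; have /andP[? ?] := g01 h.
  by move: IHh; rewrite -natr1 !ler_norml => /andP[? ?]; apply/andP; split; lra.
rewrite exchange_big /= mulr_natl -[H in _ *+ H]card_ord -sumr_const -sumrB.
apply: le_trans (ler_norm_sum _ _ _) _.
rewrite mulr_natl -[X in _ <= _ *+ X]card_ord -sumr_const; apply: ler_sum => h _.
by apply: le_trans (shift h) _; rewrite ler_nat ltnW.
Qed.

(** To compare the means of g and t it is enough that t m predicts the average of
    g over the H terms from m on, with an error that is small in the mean; H may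
    depend on the accuracy wanted. *)
Lemma mean_cvg_of_blocks (g t : nat -> R) (L : R) :
  (forall n, 0 <= g n <= 1) -> (forall n, 0 <= t n <= 1) ->
  (\sum_(n < N) t n) / N%:R @[N --> \oo] --> L ->
  (forall eps, 0 < eps -> exists (H : nat) (err : nat -> R) (l : R),
     [/\ (0 < H)%N, (forall n, 0 <= err n),
      \forall m \near \oo,
        `|\sum_(h < H) g (m + h)%N - H%:R * t m| <= H%:R * err m,
      (\sum_(n < N) err n) / N%:R @[N --> \oo] --> l & l < eps]) ->
  (\sum_(n < N) g n) / N%:R @[N --> \oo] --> L.
Proof.
move=> g01 t01 tL blocks; apply/cvgrPdist_le => eps eps0.
have eps4 : 0 < eps / 4%:R by lra.
have [H [err [l [H0 err0 [M0 _ approx] err_cvg l_lt]]]] := blocks _ eps4.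
have Hr0 : 0 < H%:R :> R by rewrite ltr0n.
have main N : `|\sum_(n < N) g n - \sum_(n < N) t n| <= (H + M0)%:R + \sum_(n < N) err n.
  rewrite -(ler_pM2l Hr0) -[X in X * `|_|]gtr0_norm // -normrM.
  have near_all m : `|\sum_(h < H) g (m + h)%N - H%:R * t m|
      <= H%:R * ((m < M0)%N%:R + err m).
    have [mM|Mm] := ltnP m M0; last by rewrite add0r; apply: approx.
    have /andP[t0 t1] := t01 m.
    have : 0 <= \sum_(h < H) g (m + h)%N <= H%:R.
      apply/andP; split; first by apply: sumr_ge0 => h _; case/andP: (g01 (m + h)%N).
      rewrite -[H in leRHS]card_ord -sum1_card natr_sum.
      by apply: ler_sum => h _; case/andP: (g01 (m + h)%N).
    move=> /andP[? ?]; have Herr : 0 <= H%:R * err m by rewrite mulr_ge0.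
    have Ht0 : 0 <= H%:R * t m by rewrite mulr_ge0.
    have Ht1 : H%:R * t m <= H%:R by rewrite ler_piMr.
    by rewrite mulrDr mulr1 ler_norml; apply/andP; split; lra.
  have few : \sum_(m < N) (m < M0)%N%:R <= M0%:R :> R.
    rewrite -natr_sum ler_nat; elim: N => [|N IHN]; first by rewrite big_ord0.
    rewrite big_ord_recr /=; have [NM|_] := ltnP N M0; last by rewrite addn0.
    apply: leq_trans NM; rewrite addn1 ltnS.
    apply: leq_trans (_ : \sum_(m < N) 1 <= _)%N; last by rewrite sum1_card card_ord.
    by apply: leq_sum => m _; apply: leq_b1.
  set S := \sum_(n < N) g n; set T := \sum_(n < N) t n.
  set B := \sum_(m < N) \sum_(h < H) g (m + h)%N.
  have hB : `|B - H%:R * T| <= H%:R * (M0%:R + \sum_(n < N) err n).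
    rewrite mulr_sumr -sumrB; apply: le_trans (ler_norm_sum _ _ _) _.
    apply: (@le_trans _ _ (\sum_(m < N) H%:R * ((m < M0)%N%:R + err m))).
      by apply: ler_sum => m _; apply: near_all.
    by rewrite -mulr_sumr big_split ler_wpM2l // lerD2r.
  have -> : H%:R * (S - T) = (H%:R * S - B) + (B - H%:R * T) by ring.
  apply: le_trans (ler_normD _ _) _.
  apply: le_trans (lerD (block_sum_swap H N g01) hB) _.
  by rewrite -mulrDr natrD addrA.
have cst_cvg : (H + M0)%:R / N%:R @[N --> \oo] --> (0 : R).
  rewrite -cvg_shiftS.
  have := cvgM (cvg_cst ((H + M0)%:R : R)) (@cvg_harmonic R).
  by rewrite mulr0; apply.
have small_cst : \forall N \near \oo, (H + M0)%:R / N%:R < eps / 4%:R.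
  exact: (cvgr_lt _ cst_cvg).
have small_err : \forall N \near \oo, (\sum_(n < N) err n) / N%:R < eps / 4%:R.
  exact: (cvgr_lt _ err_cvg).
have small_t : \forall N \near \oo, `|L - (\sum_(n < N) t n) / N%:R| <= eps / 4%:R.
  by move/cvgrPdist_le: tL; apply.
near=> N.
have c1 : (H + M0)%:R / N%:R < eps / 4%:R by near: N.
have c2 : (\sum_(n < N) err n) / N%:R < eps / 4%:R by near: N.
have c3 : `|L - (\sum_(n < N) t n) / N%:R| <= eps / 4%:R by near: N.
have c4 : `|(\sum_(n < N) t n) / N%:R - (\sum_(n < N) g n) / N%:R|
    <= (H + M0)%:R / N%:R + (\sum_(n < N) err n) / N%:R.
  by rewrite -mulrBl -mulrDl normrM distrC ger0_norm ?invr_ge0 // ler_wpM2r // invr_ge0.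
have := ler_distD ((\sum_(n < N) t n) / N%:R) L ((\sum_(n < N) g n) / N%:R).
lra.
Unshelve. all: by end_near. Qed.

End BlockMeans.

(** * Floors of powers *)

Section FloorPowers.
Variables (R : realType) (alpha : R) (k r : nat).
Hypotheses (alpha1 : 1 < alpha) (alpha2 : alpha < 2).
Hypotheses (k3 : (3 <= k)%N) (r1 : (1 <= r)%N).

Let v (n j : nat) : int := Num.floor ((n + r * j)%N%:R `^ alpha : R).

Lemma floor_pow_seq_progP n :
  floor_pow_seq alpha r k n \in arith_prog k <->
  [/\ forall j, (j < k)%N -> 0 < v n j,
      forall j, (j.+1 < k)%N -> v n j < v n j.+1 &
      exists d : int, forall j, (j.+1 < k)%N -> v n j.+1 - v n j = d].
Proof.
have nthE j : (j < k)%N -> (floor_pow_seq alpha r k n)`_j = v n j.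
  by move=> jk; rewrite (nth_mktuple _ 0 (Ordinal jk)).
rewrite inE /arith_prog /=; split=> -[pos inc [d dP]]; split.
- by move=> j jk; rewrite -nthE ?pos.
- by move=> j jk; rewrite -!nthE ?inc // ltnW.
- by exists d => j jk; rewrite -!nthE ?dP // ltnW.
- by move=> j jk; rewrite nthE ?pos.
- by move=> j jk; rewrite !nthE ?inc // ltnW.
- by exists d => j jk; rewrite !nthE ?dP // ltnW.
Qed.

(** The derivative of the power at m + 1, the base point of the block of index m;
    all indices are shifted by one to keep base points positive. *)
Definition slope (m : nat) : R := alpha * m.+1%:R `^ (alpha - 1).

(** The Taylor remainder is at most a constant times B^2 m^(alpha - 2), which tends
    to 0 as alpha < 2. *)
Lemma near_linear (B : nat) (eta : R) : 0 < eta ->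
  \forall m \near \oo, forall u, (u <= B)%N ->
    0 <= (m.+1 + u)%N%:R `^ alpha - m.+1%:R `^ alpha - u%:R * slope m <= eta.
Proof.
move=> eta0.
have c0 : 0 < 2%:R - alpha by rewrite subr_gt0.
have small : \forall m \near \oo,
    m.+1%:R `^ (- (2%:R - alpha)) < eta / (2%:R * B.+1%:R ^+ 2).
  apply: (cvgr_lt _ (powR_nat_cvg0 c0)).
  by rewrite divr_gt0 // mulr_gt0 // exprn_gt0.
apply: filterS small => m small u uB.
have m0 : 0 < m.+1%:R :> R by rewrite ltr0n.
have mu : m.+1%:R <= (m.+1 + u)%N%:R :> R by rewrite ler_nat leq_addr.
have := powR_taylor1 m0 mu (ltW alpha1) (ltW alpha2).
rewrite natrD (_ : m.+1%:R + u%:R - m.+1%:R = u%:R); last by ring.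
rewrite (_ : alpha * _ * u%:R = u%:R * slope m); last by rewrite mulrC.
move=> /andP[-> /le_trans]; apply.
have B0 : 0 < 2%:R * B.+1%:R ^+ 2 :> R by rewrite mulr_gt0 // exprn_gt0.
move: small; rewrite opprB ltr_pdivlMr // => small.
have p0 : 0 <= m.+1%:R `^ (alpha - 2%:R) by apply: powR_ge0.
have u2 : u%:R ^+ 2 <= B.+1%:R ^+ 2 :> R.
  by rewrite ler_sqr ?nnegrE // ler_nat ltnW.
apply: le_trans (ltW small); rewrite -mulrA [leRHS]mulrC -[leRHS]mulrA.
rewrite mulrC.
have aa : alpha * (alpha - 1) <= 2%:R by move: alpha1 alpha2 => a1 a2; nra.
have : m.+1%:R `^ (alpha - 2%:R) * u%:R ^+ 2 <= B.+1%:R ^+ 2 * m.+1%:R `^ (alpha - 2%:R).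
  by rewrite mulrC ler_wpM2r.
have : 0 <= m.+1%:R `^ (alpha - 2%:R) * u%:R ^+ 2 by rewrite mulr_ge0 // sqr_ge0.
nra.
Qed.

Lemma slope_ge2 : \forall m \near \oo, 2%:R <= slope m.
Proof.
have a0 : 0 < alpha - 1 by rewrite subr_gt0.
have small : \forall m \near \oo, m.+1%:R `^ (- (alpha - 1)) < 2%:R^-1 :> R.
  by apply: (cvgr_lt _ (powR_nat_cvg0 a0)); rewrite invr_gt0.
apply: filterS small => m; rewrite powRN ltf_pV2 ?posrE ?powR_gt0 // => h.
have p0 : 0 <= m.+1%:R `^ (alpha - 1) by apply: powR_ge0.
by move: alpha1 => a1; rewrite /slope; nra.
Qed.

(** The index is shifted here as well: [good n] concerns the integer n + 1. *)
Let good n : R := (floor_pow_seq alpha r k n.+1 \in arith_prog k)%:R.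

Let c : R := k.-1%:R.

(** One block, on which the power is linear up to [eta]. A step of r in n moves
    the linear approximation by r times the slope, which is [p + s]. *)
Section OneBlock.
Variables (m B : nat) (eta : R).
Hypothesis approx : forall u, (u <= B)%N ->
    0 <= (m.+1 + u)%N%:R `^ alpha - m.+1%:R `^ alpha - u%:R * slope m <= eta.
Hypothesis steep : 2%:R <= slope m.

Let p := nearest (r%:R * slope m).
Let s : R := r%:R * slope m - p%:~R.
Let X h : R := m.+1%:R `^ alpha + h%:R * slope m.
Let a := ap_start k s.
Let len := ap_length k s.
Let e h j := (m.+1 + (h + r * j))%N%:R `^ alpha - m.+1%:R `^ alpha
  - (h + r * j)%N%:R * slope m.

Lemma eta_ge0 : 0 <= eta.
Proof. by have /andP[] := approx (leq0n _); apply: le_trans. Qed.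

Lemma floor_block h j : v (m + h).+1 j = Num.floor (X h + j%:R * (p%:~R + s) + e h j).
Proof.
rewrite /v (_ : ((m + h).+1 + r * j)%N = (m.+1 + (h + r * j))%N); last by lia.
rewrite /X /s /e; set P := (m.+1 + _)%N%:R `^ alpha; rewrite natrD natrM.
by congr Num.floor; ring.
Qed.

Lemma good_lower h : (h + r * k <= B)%N ->
  (window a (a + Num.max 0 (len - eta)) (X h))%:~R <= good (m + h).
Proof.
move=> hB; have /andP[len0 len1] : 0 <= len <= 1 := ap_length_itv k s.
have eta0 := eta_ge0.
have e_itv j : (j < k)%N -> 0 <= e h j <= eta.
  move=> jk; apply: approx; apply: leq_trans hB.
  by rewrite leq_add2l leq_mul2l ltnW ?orbT.
have [w0|w0] := lerP (window a (a + Num.max 0 (len - eta)) (X h)) 0.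
  by apply: (@le_trans _ _ 0); rewrite ?lerz0 // /good ler0n.
have [n nP] := floor_progression_of_window p e_itv w0.
have vP j : (j < k)%N -> v (m + h).+1 j = n + p * j%:Z.
  by move=> jk; rewrite floor_block nP.
have p0 : 0 < p.
  rewrite /p /nearest floor_gt0; have : 1 <= r%:R :> R by rewrite ler1n.
  by move: steep => st; nra.
have -> : good (m + h) = 1.
  rewrite /good (_ : _ \in _) //; apply/floor_pow_seq_progP; split.
  - move=> j jk; rewrite /v floor_gt0; set x : R := _%:R.
    have x1 : 1 <= x by rewrite ler1n.
    exact: le_trans x1 (@le1r_powR R _ _ x1 (ltW alpha1)).
  - by move=> j jk; rewrite !vP ?(ltnW jk) //; nia.
  - by exists p => j jk; rewrite !vP ?(ltnW jk) // -[j.+1]add1n PoszD; ring.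
by rewrite lerz1 window_le1 // lerD2l ge_max ler01; lra.
Qed.

Lemma good_upper h : (h + r * k <= B)%N ->
  good (m + h) <= (window (a - eta) (a + len) (X h) + window (1 - eta) 1 (X h))%:~R.
Proof.
move=> hB; have /andP[len0 len1] : 0 <= len <= 1 := ap_length_itv k s.
have eta0 := eta_ge0.
have e_itv j : (j < k)%N -> 0 <= e h j <= eta.
  move=> jk; apply: approx; apply: leq_trans hB.
  by rewrite leq_add2l leq_mul2l ltnW ?orbT.
rewrite /good; case: (boolP (_ \in _)) => [/floor_pow_seq_progP[_ _ [d dP]]|_]; last first.
  by rewrite ler0z addr_ge0 // window_ge0 //; lra.
rewrite ler1z; apply: (window_of_floor_progression (p := p) k3 _ eta0 e_itv).
  exact: dist_int_le_half.
by exists d => j jk; rewrite -!floor_block dP.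
Qed.

Lemma good_block_sum q p' H : (0 < q)%N -> (q %| H)%N -> coprimez p' q ->
  `|q%:R * slope m - p'%:~R| <= q%:R^-1 -> (H + r * k <= B)%N ->
  `|\sum_(h < H) good (m + h)%N - H%:R * tent c (r%:R * slope m)|
    <= H%:R * (2%:R * eta + 6%:R / q%:R).
Proof.
move=> q0 qH cop near_pq HB; have eta0 := eta_ge0.
have /andP[len0 len1] : 0 <= len <= 1 := ap_length_itv k s.
have hB (h : 'I_H) : (h + r * k <= B)%N.
  by apply: leq_trans HB; rewrite leq_add2r ltnW.
have win u w := @window_sum_long R H q p' (slope m) u w
  (m.+1%:R `^ alpha) q0 qH cop near_pq.
rewrite -[tent _ _]/len.
set S := \sum_(h < H) good _.
have lower : (\sum_(h < H) window a (a + Num.max 0 (len - eta)) (X h))%:~R <= S.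
  by rewrite (raddf_sum (intmul 1)); apply: ler_sum => h _; apply: good_lower.
have upper : S <= (\sum_(h < H) window (a - eta) (a + len) (X h))%:~R
    + (\sum_(h < H) window (1 - eta) 1 (X h))%:~R.
  rewrite -intrD -big_split /= (raddf_sum (intmul 1)); apply: ler_sum => h _.
  exact: good_upper.
have H0 : 0 <= H%:R :> R by [].
have l1 : len - eta <= Num.max 0 (len - eta) by rewrite le_max lexx orbT.
have l2 : H%:R * (len - eta) <= H%:R * Num.max 0 (len - eta) by rewrite ler_wpM2l.
have w1 : a <= a + Num.max 0 (len - eta) by rewrite lerDl le_max lexx.
have w2 : a - eta <= a + len by lra.
have w3 : 1 - eta <= 1 by lra.
have := win _ _ w1; have := win _ _ w2; have := win _ _ w3.
rewrite !ler_norml.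
move=> /andP[_ h3] /andP[_ h2] /andP[h1 _].
have E : H%:R * (2%:R * eta + 6%:R / q%:R)
  = 2%:R * (H%:R * eta) + 2%:R * (3%:R * H%:R / q%:R) by ring.
have Heta : 0 <= H%:R * eta by rewrite mulr_ge0.
have Hq : 0 <= 3%:R * H%:R / q%:R :> R by rewrite !mulr_ge0 // invr_ge0.
rewrite E; apply/andP; split; nra.
Qed.

End OneBlock.

(** Either the denominator q of the Dirichlet approximation exceeds K, and
    [good_block_sum] applies with eta = 1/K; or q <= K, and the term i = q - 1 of
    the sum on the right is at least 1, which makes the bound trivial. *)
Lemma good_block_approx (K Q : nat) : (0 < K)%N -> (0 < Q)%N ->
  \forall m \near \oo,
    `|\sum_(h < Q`!) good (m + h)%N - Q`!%:R * tent c (r%:R * slope m)|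
    <= Q`!%:R * (8%:R / K%:R
         + \sum_(i < K) 2%:R * tent (Q%:R / 2%:R) (i.+1%:R * slope m)).
Proof.
move=> K0 Q0; set H := Q`!.
have Kr0 : 0 < K%:R :> R by rewrite ltr0n.
have Qr0 : 0 < Q%:R :> R by rewrite ltr0n.
have eta0 : 0 < K%:R^-1 :> R by rewrite invr_gt0.
have := near_linear (H + r * k) eta0; apply: filter_app.
apply: filterS slope_ge2 => m steep approx.
have H0 : 0 <= H%:R :> R by [].
have tents0 : 0 <= \sum_(i < K) 2%:R * tent (Q%:R / 2%:R) (i.+1%:R * slope m).
  by apply: sumr_ge0 => i _; rewrite mulr_ge0 // tent_ge0.
have [q [p [/andP[q0 qQ] cop near_pq]]] := dirichlet_coprime (slope m) Q0.
have qr0 : 0 < q%:R :> R by rewrite ltr0n.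
have [Kq|qK] := ltnP K q.
  have near_q : `|q%:R * slope m - p%:~R| <= q%:R^-1.
    by apply: le_trans (ltW near_pq) _; rewrite lef_pV2 ?posrE // ler_nat.
  have qH : (q %| H)%N by rewrite dvdn_fact // q0.
  apply: le_trans (good_block_sum approx steep q0 qH cop near_q (leqnn _)) _.
  rewrite ler_wpM2l //.
  have : q%:R^-1 <= K%:R^-1 :> R by rewrite lef_pV2 ?posrE // ler_nat ltnW.
  lra.
have q1K : (q.-1 < K)%N by lia.
have big_tent : 1 <= \sum_(i < K) 2%:R * tent (Q%:R / 2%:R) (i.+1%:R * slope m).
  rewrite (bigD1 (Ordinal q1K)) //= prednK //.
  have rest : 0 <= \sum_(i < K | i != Ordinal q1K)
      2%:R * tent (Q%:R / 2%:R) (i.+1%:R * slope m).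
    by apply: sumr_ge0 => i _; rewrite mulr_ge0 // tent_ge0.
  have Q2 : 0 <= Q%:R / 2%:R :> R by rewrite divr_ge0.
  have := tent_ge (q%:R * slope m) p Q2.
  have : Q%:R / 2%:R * `|q%:R * slope m - p%:~R| <= 2%:R^-1.
    rewrite -(ltr_pM2l Qr0) divff ?lt0r_neq0 // in near_pq; lra.
  lra.
have : 0 <= \sum_(h < H) good (m + h)%N <= H%:R.
  apply/andP; split; first by apply: sumr_ge0 => h _; rewrite /good ler0n.
  rewrite -[H in leRHS]card_ord -sum1_card natr_sum.
  by apply: ler_sum => h _; rewrite /good lern1 leq_b1.
move=> /andP[S0 S1].
have c0 : 0 <= c by rewrite /c.
have t0 := tent_ge0 c (r%:R * slope m); have t1 := tent_le1 (r%:R * slope m) c0.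
have Ht0 : 0 <= H%:R * tent c (r%:R * slope m) by rewrite mulr_ge0.
have Ht1 : H%:R * tent c (r%:R * slope m) <= H%:R by rewrite ler_piMr.
apply: (@le_trans _ _ H%:R); first by rewrite ler_norml; apply/andP; split; lra.
rewrite ler_peMr //.
have : 0 <= 8%:R / K%:R :> R by rewrite divr_ge0.
lra.
Qed.

Lemma mean_tent_slope (d b : R) : 2%:R <= d -> 0 < b ->
  (\sum_(n < N) tent d (b * slope n)) / N%:R @[N --> \oo] --> d^-1.
Proof.
move=> d2 b0; have := @mean_tent_along_power R d (b * alpha) (alpha - 1) d2.
have ba0 : 0 < b * alpha by rewrite mulr_gt0 // (lt_trans _ alpha1).
move=> /(_ ba0) h; rewrite /slope.
have {}h := h _ _; under eq_cvg => N do under eq_bigr => n _ do rewrite mulrA.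
by move: alpha1 alpha2 => a1 a2; apply: h; lra.
Qed.

Lemma mean_good : (\sum_(n < N) good n) / N%:R @[N --> \oo] --> c^-1.
Proof.
have c2 : 2%:R <= c by rewrite /c ler_nat; lia.
have rr0 : 0 < r%:R :> R by rewrite ltr0n.
apply: (@mean_cvg_of_blocks R good (fun m => tent c (r%:R * slope m))).
- by move=> n; rewrite /good ler0n lern1 leq_b1.
- by move=> n; rewrite tent_ge0 tent_le1 // /c.
- exact: mean_tent_slope.
move=> eps eps0.
(* the error is 8/K plus K tents of mean 2/Q, each doubled: 9/K in total *)
pose K := (Num.truncn (9%:R / eps)).+1.
have Kr0 : 0 < K%:R :> R by rewrite ltr0n.
have KP : 9%:R / K%:R < eps.
  rewrite ltr_pdivrMr // mulrC -ltr_pdivrMr //; exact: truncnS_gt.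
pose Q := (4 * K ^ 2)%N.
have Q0 : (0 < Q)%N by rewrite muln_gt0 expn_gt0.
pose d : R := Q%:R / 2%:R.
have dE : d = 2%:R * K%:R ^+ 2 by rewrite /d /Q natrM natrX; field.
have K1 : 1 <= K%:R :> R by rewrite ler1n.
have d2 : 2%:R <= d by rewrite dE; nra.
exists Q`!, (fun m => 8%:R / K%:R + \sum_(i < K) 2%:R * tent d (i.+1%:R * slope m)).
exists (9%:R / K%:R); split => //.
- exact: fact_gt0.
- move=> n; rewrite addr_ge0 ?divr_ge0 //; apply: sumr_ge0 => i _.
  by rewrite mulr_ge0 // tent_ge0.
- exact: good_block_approx.
have -> : 9%:R / K%:R = 8%:R / K%:R + \sum_(i < K) 2%:R * d^-1 :> R.
  by rewrite sumr_const card_ord -mulr_natr dE; field; rewrite gt_eqF.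
have lim : (8%:R / K%:R + \sum_(i < K) 2%:R *
    ((\sum_(n < N) tent d (i.+1%:R * slope n)) / N%:R)) @[N --> \oo]
    --> (8%:R / K%:R + \sum_(i < K) 2%:R * d^-1 : R).
  apply: cvgD; first exact: cvg_cst.
  apply: cvg_big; first exact: add_continuous.
  move=> i _; apply: cvgM; first exact: cvg_cst.
  exact: mean_tent_slope.
apply: cvg_trans lim; apply: near_eq_cvg; near=> N.
have N0 : N%:R != 0 :> R by rewrite pnatr_eq0 -lt0n; near: N; exists 1%N.
rewrite /= big_split /= sumr_const card_ord [RHS]mulrDl.
rewrite -(mulr_natr (8%:R / K%:R) N) mulfK //.
congr (_ + _); rewrite exchange_big /= mulr_suml; apply: eq_bigr => i _.
by rewrite -mulr_sumr mulrA.
Unshelve. all: by end_near. Qed.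

End FloorPowers.

Unset Implicit Arguments.

Theorem corollary1p2 (R : realType) (alpha : R) (k r : nat)
    (halpha1 : 1 < alpha) (halpha2 : alpha < 2)
    (hk : (3 <= k)%N) (hr : (1 <= r)%N) :
  (fun N : nat =>
     #|[pred n : 'I_N.+1 |
          (1 <= n)%N && (floor_pow_seq alpha r k n \in arith_prog k)]|%:R
       / N%:R : R) @ \oo --> (1 / (k%:R - 1) : R).
Proof.
have -> : 1 / (k%:R - 1) = k.-1%:R^-1 :> R.
  by rewrite div1r -subn1 natrB //; lia.
apply: cvg_trans (mean_good halpha1 halpha2 hk hr).
apply: near_eq_cvg; near=> N => /=; congr (_ / _).
apply: esym; rewrite -sum1_card big_mkcond big_ord_recl /= add0n natr_sum.
by apply: eq_bigr => n _; rewrite inE /=; case: (_ \in _).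
Unshelve. all: by end_near. Qed.
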